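(* For every $n\ge 5$, the sequence $\mathcal T_{n,*}=[\mathcal T_{n,1},\dots,\mathcal T_{n,n+1}]$ is strictly positive and near-log-concave of degree $1$ with $\mathcal I_n^{(1)}=\mathcal I_n\setminus\{4\}$, where $\mathcal I_n=\{2,\dots,n\}$.
   Context: Define $\psi:\{1,2,3,\dots\}\to\{0,1,2,\dots\}$ by $\psi(1)=0$, $\psi(2)=1$, $\psi(3)=2$ and $\psi(j)=\sum_{k=1}^{j-1}\psi(k)$ for $j\ge 4$. The triangular array $\mathcal T=(\mathcal T_{n,j})$, $n\ge 0$, $1\le j\le n+1$, of integers is defined recursively by: $\mathcal T_{n,n+1}=1$ for every $n\ge 0$; $\mathcal T_{1,1}=1$, $\mathcal T_{2,2}=2$, $\mathcal T_{3,3}=3$; $\mathcal T_{n,n}=\sum_{k=1}^{n-2}\mathcal T_{n-k,n-k}$ for every $n\ge 4$; and $\mathcal T_{n,j}=\mathcal T_{n-1,j}+\psi(j)$ for every $n\ge 2$ and $1\le j\le n-1$. Near-log-concavity: a real sequence $[\eta_1,\dots,\eta_{n+1}]$, $n\ge 2$, is near-log-concave of degree $r$ (an integer with $0\le r\le n-2$) with index set $\mathcal I_n^{(r)}$ if $\mathcal I_n^{(r)}\subseteq\mathcal I_n=\{2,\dots,n\}$, $|\mathcal I_n^{(r)}|=n-r-1$, and $\eta_{i-1}\eta_{i+1}\le\eta_i^2$ for all $i\in\mathcal I_n^{(r)}$. *)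

(* Defs.v *)
From mathcomp Require Import all_boot all_order all_algebra.
From mathcomp Require Import finmap.
Set Implicit Arguments.
Unset Strict Implicit.
Unset Printing Implicit Defensive.
Import Order.TTheory GRing.Theory Num.Theory.
Local Open Scope nat_scope.

(* Course-of-values recursion: [course step n] lists the first [n] values,
   each one computed by [step] from the list of all preceding values. *)
Fixpoint course (A : Type) (step : seq A -> A) (n : nat) : seq A :=
  if n is m.+1 then rcons (course step m) (step (course step m)) else [::].

(* [s] lists psi(1), ..., psi(size s). *)
Definition psi_step (s : seq nat) : nat :=
  match (size s).+1 with
  | 1 => 0
  | 2 => 1
  | 3 => 2
  | _ => \sum_(x <- s) x
  end.

(* Indices start at 1; psi 0 is a junk value.  The defining equations are
   proved below as psi1, psi2, psi3 and psi_rec. *)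
Definition psi (j : nat) : nat := nth 0 (course psi_step j) j.-1.

(* [s] lists T_{1,1}, ..., T_{n-1,n-1} where n = (size s).+1; the sum of
   T_{n-k,n-k} over 1 <= k <= n-2 leaves out T_{1,1}, hence [behead]. *)
Definition diag_step (s : seq int) : int :=
  match (size s).+1 with
  | 1 => 1%R
  | 2 => 2%R
  | 3 => 3%R
  | _ => (\sum_(x <- behead s) x)%R
  end.

Definition diag (n : nat) : int := nth 0%R (course diag_step n) n.-1.

(* Only the entries with 1 <= j <= n.+1 are meaningful.  The defining equations
   are proved below: Tarray_last, Tarray11, Tarray22, Tarray33, Tarray_diag and
   Tarray_rec. *)
Fixpoint Tarray (n j : nat) : int :=
  if j == n.+1 then 1%R
  else if j == n then diag n
  else if n is m.+1 then (Tarray m j + (psi j)%:Z)%R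
  else 0%R.

Definition index_range (n : nat) : {fset nat} := [fset i in iota 2 n.-1]%fset.

(* The finite sequence [eta_1, ..., eta_{n+1}] is represented by a function on
   nat of which only the values at 1, ..., n.+1 are used. *)
Definition near_log_concave (R : realFieldType) (n : nat) (eta : nat -> R)
    (r : nat) (I : {fset nat}) : Prop :=
  [/\ 2 <= n,
      r <= n - 2,
      (I `<=` index_range n)%fset,
      #|` I|%fset = n - r - 1
    & forall i, i \in I -> (eta i.-1 * eta i.+1 <= eta i ^+ 2)%R].

Lemma size_course (A : Type) (step : seq A -> A) n : size (course step n) = n.
Proof. by elim: n => //= n IH; rewrite size_rcons IH. Qed.

Lemma nth_course (A : Type) (x : A) (step : seq A -> A) n i :
  i < n -> nth x (course step n) i = step (course step i).
Proof.
elim: n => // n IH; rewrite ltnS leq_eqVlt /= nth_rcons size_course.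
by case/orP => [/eqP -> | lt_in]; rewrite ?ltnn ?eqxx // lt_in IH.
Qed.

Lemma courseE (A : Type) (x : A) (step : seq A -> A) n :
  course step n = [seq nth x (course step k.+1) k | k <- iota 0 n].
Proof.
apply: (@eq_from_nth _ x); first by rewrite size_map size_iota size_course.
move=> i; rewrite size_course => lt_in.
by rewrite (nth_map 0) ?size_iota // nth_iota // add0n !nth_course.
Qed.

Lemma psi1 : psi 1 = 0. Proof. by []. Qed.
Lemma psi2 : psi 2 = 1. Proof. by []. Qed.
Lemma psi3 : psi 3 = 2. Proof. by []. Qed.

Lemma psi_rec j : 4 <= j -> psi j = \sum_(1 <= k < j) psi k.
Proof.
case: j => [|[|[|[|j]]]] // _.
rewrite {1}/psi nth_course // /psi_step size_course (courseE 0) big_map.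
by rewrite big_add1 /index_iota subn0.
Qed.

Lemma TarrayE n j : Tarray n j =
  if j == n.+1 then 1%R
  else if j == n then diag n
  else if n is m.+1 then (Tarray m j + (psi j)%:Z)%R
  else 0%R.
Proof. by case: n. Qed.

Lemma Tarray_last n : Tarray n n.+1 = 1%R.
Proof. by rewrite TarrayE eqxx. Qed.

Lemma Tarray_diagE n : Tarray n n = diag n.
Proof. by rewrite TarrayE ltn_eqF // eqxx. Qed.

Lemma Tarray11 : Tarray 1 1 = 1%R. Proof. by []. Qed.
Lemma Tarray22 : Tarray 2 2 = 2%R. Proof. by []. Qed.
Lemma Tarray33 : Tarray 3 3 = 3%R. Proof. by []. Qed.

Lemma Tarray_diag n : 4 <= n ->
  Tarray n n = (\sum_(1 <= k < n.-1) Tarray (n - k) (n - k))%R.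
Proof.
case: n => [|[|[|[|n]]]] // _.
rewrite Tarray_diagE /diag nth_course // /diag_step size_course.
rewrite (courseE 0%R) behead_map big_map.
rewrite -[behead (iota _ _)]/(index_iota 1 n.+3) big_nat_rev.
apply: eq_big_nat => k /andP[k_gt0 lt_kn]; rewrite Tarray_diagE /diag.
have -> : 1 + n.+3 - k.+1 = n.+3 - k by rewrite add1n subSS.
by rewrite (@subSn k n.+3) // ltnW.
Qed.

Lemma Tarray_rec n j : 2 <= n -> 1 <= j <= n.-1 ->
  Tarray n j = (Tarray n.-1 j + (psi j)%:Z)%R.
Proof.
case: n => // n _ /andP[_ le_jn].
by rewrite TarrayE !ltn_eqF // ltnS // ltnW.
Qed.

Lemma in_index_range n i : 1 <= n -> (i \in index_range n) = (2 <= i <= n).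
Proof.
by case: n => // n _; rewrite inE /= mem_iota addSn add1n ltnS.
Qed.

(* Main.v *)
Require Import Defs.
From mathcomp Require Import all_boot all_order all_algebra.
From mathcomp Require Import finmap.
From mathcomp Require Import zify.
Set Implicit Arguments.
Unset Strict Implicit.
Unset Printing Implicit Defensive.
Import Order.TTheory GRing.Theory Num.Theory.
Local Open Scope nat_scope.

(** In both recursions the sum for the next term is the sum for the current term
    plus the current term itself, so the terms double: from index 4 on,
    [psi] and the diagonal are geometric of ratio 2, starting at 3 and 5.
    Down a fixed column the array grows linearly with slope [psi j], hence row
    [n] reads
      1, n, 2n - 3, then 2^m (5 + 3 (n - m - 4)) at j = m + 4 <= n, then 1.
    Everything is positive.  From column 4 to column [n] the row is a geometric
    progression times a positive arithmetic one, and both factors are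
    log-concave: (a + 3) (a - 3) <= a^2.  The remaining cases are boundary
    effects: i = 2 is 2n - 3 <= n^2, i = 3 is n (3n - 7) <= (2n - 3)^2, and at
    i = n the last entry 1 is too small to matter.  Index 4, where the first
    three columns meet the geometric regime, is the only one excluded. *)

Lemma psi_geometric m : psi (m + 4) = 3 * 2 ^ m.
Proof.
elim: m => [|m IH]; first by rewrite psi_rec // unlock.
rewrite addSn psi_rec; last by lia.
by rewrite big_nat_recr /=; last lia; rewrite -psi_rec ?IH ?expnS; lia.
Qed.

Lemma Tarray_diag_geometric m : Tarray (m + 4) (m + 4) = (5 * 2 ^ m)%:Z%R.
Proof.
elim: m => [|m IH]; first by rewrite Tarray_diag // unlock.
(* the term k = 1 is the previous diagonal entry, and the terms k >= 2 are
   the sum that defines it *)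
rewrite addSn Tarray_diag; last by lia.
have -> : (m + 4).+1.-1 = (m + 4).-1.+1 by lia.
rewrite big_nat_recl; last by lia.
under eq_bigr => k _ do rewrite subSS.
by rewrite -Tarray_diag ?subn1 /= ?IH ?expnS; lia.
Qed.

Lemma Tarray_column j d : 1 <= j ->
  Tarray (j + d) j = (Tarray j j + (d * psi j)%:Z)%R.
Proof.
move=> j_gt0; elim: d => [|d IH]; first by rewrite addn0 addr0.
rewrite addnS Tarray_rec; [|lia..].
by rewrite /= IH mulSn; lia.
Qed.

Lemma Tarray_col1 n : 1 <= n -> Tarray n 1 = 1%R.
Proof. by move=> n_gt0; rewrite -(subnKC n_gt0) Tarray_column // psi1 muln0. Qed.

Lemma Tarray_col2 n : 2 <= n -> Tarray n 2 = n%:Z%R.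
Proof.
by move=> n_ge2; rewrite -{1}(subnKC n_ge2) Tarray_column // psi2 Tarray22; lia.
Qed.

Lemma Tarray_col3 n : 3 <= n -> Tarray n 3 = (2 * n - 3)%:Z%R.
Proof.
by move=> n_ge3; rewrite -{1}(subnKC n_ge3) Tarray_column // psi3 Tarray33; lia.
Qed.

(** Column [m + 4] starts at 5 * 2^m and has slope 3 * 2^m, so the power of 2
    factors out: along a row the entry is geometric times arithmetic. *)
Lemma Tarray_geometric m d :
  Tarray (m + 4 + d) (m + 4) = (2 ^ m * (5 + 3 * d))%:Z%R.
Proof.
rewrite Tarray_column; last by lia.
by rewrite psi_geometric Tarray_diag_geometric; lia.
Qed.

Lemma Tarray_gt0 n j : 5 <= n -> 1 <= j <= n.+1 -> (0 < Tarray n j)%R.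
Proof.
move=> n_ge5 /andP[j_gt0]; rewrite leq_eqVlt => /predU1P[->|le_jn].
  by rewrite Tarray_last.
case: j j_gt0 le_jn => [|[|[|[|m]]]] // _ le_mn.
- by rewrite Tarray_col1 //; lia.
- by rewrite Tarray_col2 //; lia.
- by rewrite Tarray_col3 //; lia.
have -> : n = m + 4 + (n - (m + 4)) by lia.
by rewrite -[m.+4]addn4 Tarray_geometric ltz_nat muln_gt0 expn_gt0.
Qed.

(** With i = m + 5, n = i + d and a = 5 + 3 d, the three entries are
    2^m (a + 3), 2^(m+1) a and 2^(m+2) (a - 3), and the inequality reduces to
    a^2 - 9 <= a^2.  Indices 2 and 3 are quadratic inequalities in n. *)
Lemma Tarray_log_concave n i : 5 <= n -> 2 <= i <= n -> i != 4 ->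
  (Tarray n i.-1 * Tarray n i.+1 <= Tarray n i ^+ 2)%R.
Proof.
move=> n_ge5 /andP[i_ge2 le_in] i_neq4.
case: i i_ge2 le_in i_neq4 => [|[|[|[|[|m]]]]] //= _ le_mn _.
- by rewrite Tarray_col1 ?Tarray_col2 ?Tarray_col3; nia.
- rewrite Tarray_col2 ?Tarray_col3; [|lia..].
  have -> : n = 0 + 4 + (n - 4) by lia.
  by rewrite (Tarray_geometric 0); nia.
have [d def_n] : exists d, n = m.+1 + 4 + d by exists (n - (m.+1 + 4)); lia.
have e4 : Tarray n m.+4 = (2 ^ m * (5 + 3 * d.+1))%:Z%R.
  by rewrite -[m.+4]addn4 -Tarray_geometric; congr Tarray; lia.
have e5 : Tarray n m.+4.+1 = (2 ^ m.+1 * (5 + 3 * d))%:Z%R.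
  by rewrite -Tarray_geometric; congr Tarray; lia.
rewrite e4 e5.
(* d = 0 is i = n: the right neighbour is the final entry 1, which lies outside
   the geometric formula. *)
case: d => [|d] in def_n {e4 e5} *.
  have -> : m.+4.+2 = n.+1 by lia.
  have := expn_gt0 2 m; rewrite Tarray_last expnS /=; nia.
have -> : Tarray n m.+4.+2 = (2 ^ m.+2 * (5 + 3 * d))%:Z%R.
  by rewrite -Tarray_geometric; congr Tarray; lia.
by rewrite !expnS; nia.
Qed.

Lemma card_index_range n : #|` index_range n|%fset = n.-1.
Proof.
rewrite /index_range card_imfset //= -[RHS](size_iota 2).
apply/perm_size/uniq_perm; rewrite ?undup_uniq ?iota_uniq // => x.
by rewrite mem_undup.
Qed.

Theorem proposition2p6 (R : realFieldType) (n : nat) (hn : 5 <= n) :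
  (forall j : nat, 1 <= j <= n.+1 -> (0 < Tarray n j)%R) /\
  near_log_concave n (fun j : nat => (Tarray n j)%:~R%R : R) 1
    (index_range n `\ 4)%fset.
Proof.
split=> [j|]; first exact: Tarray_gt0.
split; [lia | lia | exact: fsubD1set | |].
  have := cardfsD1 4 (index_range n).
  by rewrite card_index_range in_index_range; lia.
move=> i; rewrite in_fsetD1 in_index_range; last by lia.
move=> /andP[i_neq4 i_in].
by rewrite -rmorphM -rmorphXn ler_int Tarray_log_concave.
Qed.
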